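(* Fix $P_0\in\mathfrak P$ and $b_0\in\mathbb R^k$. Assume: (i) there is $\bar\mu\in\mathcal M^{P_0}$ with $\bar\mu(s,a)>0$ for all $(s,a)$ and $\Psi^\top\bar\mu<b_0$ componentwise; (ii) $f$ is strictly convex on $\mathcal X$; (iii) $f$ is essentially smooth with respect to $\mathcal M^{P}$ for every $P\in\mathfrak P$; (iv) $\mathcal R\subseteq\mathbb R^{nm}$ is convex and $\mu^E\in\mathsf{RL}^{P_0,b_0}_{\mathcal F}(r^E)$ for some $r^E\in\mathcal R$. Let $\mathcal O\subseteq\mathbb R^{nm\times n}$ be any neighborhood of $P_0$. Then IRL generalizes to $\mathcal P=\mathcal O\cap\mathfrak P$ and $\mathcal B=\mathbb R^k$ if and only if $$\mathsf{IRL}^{P_0,b_0}_{\mathcal R,\mathcal F}(\mu^E)\subseteq r^E+\operatorname{span}(\mathbf 1_{nm}).$$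
   Context: $\mathcal S=\{s_1,\dots,s_n\}$, $\mathcal A=\{a_1,\dots,a_m\}$ finite, $m>1$; vectors in $\mathbb R^{nm}$ are functions on $\mathcal S\times\mathcal A$. $\mathfrak P$ is the set of transition laws, i.e. matrices $P\in\mathbb R^{nm\times n}$ with nonnegative entries and rows summing to one. Fixed: $\nu_0\in\Delta_{\mathcal S}$, $\gamma\in(0,1)$, $\Psi\in\mathbb R^{nm\times k}$, $E=[I_n,\dots,I_n]^\top$. For $P\in\mathfrak P$, $b\in\mathbb R^k$: $\mathcal M^P=\{\mu\ge0:(E-\gamma P)^\top\mu=(1-\gamma)\nu_0\}$, $\mathcal F^{P,b}=\{\mu\in\mathcal M^P:\Psi^\top\mu\le b\}$. $\mathcal X$ closed convex, $\Delta_{\mathcal S\times\mathcal A}\subseteq\mathcal X$, $f:\mathcal X\to\mathbb R$ continuous convex. $\mathsf{RL}^{P,b}_{\mathcal F}(r)=\arg\max_{\mu\in\mathcal F^{P,b}}r^\top\mu-f(\mu)$; $\mathsf{IRL}^{P,b}_{\mathcal R,\mathcal F}(\hat\mu)=\arg\min_{r\in\mathcal R}\max_{\mu\in\mathcal F^{P,b}}r^\top(\mu-\hat\mu)-f(\mu)$. Essential smoothness w.r.t. $\mathcal M^P$: (a) $f$ is differentiable on $\operatorname{int}\mathcal X$ and $\operatorname{relint}\mathcal M^P\subseteq\operatorname{int}\mathcal X$; (b) $\|\nabla f(\mu_k)\|\to\infty$ for every sequence $(\mu_k)\subset\operatorname{int}\mathcal X$ converging to a point of $\mathcal M^P\setminus\operatorname{relint}\mathcal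 M^P$. Generalizability: IRL (at $(P_0,b_0)$, for reward class $\mathcal R$ and expert $\mu^E$) generalizes to $\mathcal P\subseteq\mathfrak P$ and $\mathcal B\subseteq\mathbb R^k$ if $\mathsf{RL}^{P,b}_{\mathcal F}(r)=\mathsf{RL}^{P,b}_{\mathcal F}(r')$ for all $P\in\mathcal P$, all $b\in\mathcal B$, and all $r,r'\in\mathsf{IRL}^{P_0,b_0}_{\mathcal R,\mathcal F}(\mu^E)$. $\mathbf 1_{nm}$ is the all-ones vector. *)

(* Defs.v *)
(* States 'I_n, actions 'I_m.  Vectors of R^{nm} (functions on S x A) are     *)
(* column vectors 'cV[R]_(m * n), the pair (s, a) being stored at index       *)
(* mxvec_index a s (= a * n + s), so that E = [I_n, ..., I_n]^T literally.    *)
From HB Require Import structures.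
From mathcomp Require Import all_boot all_order all_algebra.
From mathcomp Require Import all_classical all_reals all_analysis.
Set Implicit Arguments. Unset Strict Implicit. Unset Printing Implicit Defensive.
Import Order.TTheory GRing.Theory Num.Theory.
Import numFieldNormedType.Exports.
Local Open Scope classical_set_scope.
Local Open Scope ring_scope.

Section MDP.
Variables (R : realType) (n m : nat).
Local Notation N := (m * n)%N.

Definition sa (s : 'I_n) (a : 'I_m) : 'I_N := mxvec_index a s.

(* E = [I_n, ..., I_n]^T : E (s,a) s' = [s == s'] *)
Definition Emx : 'M[R]_(N, n) :=
  \matrix_(i, s') \sum_(a < m) \sum_(s < n) ((i == sa s a) && (s == s'))%:R.

Definition simplex d : set 'cV[R]_d :=
  [set x : 'cV[R]_d | (forall i, 0 <= x i 0) /\ \sum_i x i 0 = 1].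

Definition dotv d (x y : 'cV[R]_d) : R := \sum_i x i 0 * y i 0.

Definition transition_laws : set 'M[R]_(N, n) :=
  [set P : 'M[R]_(N, n) | (forall i j, 0 <= P i j) /\ (forall i, \sum_j P i j = 1)].

Definition occ (gamma : R) (nu0 : 'cV[R]_n) (P : 'M[R]_(N, n)) : set 'cV[R]_N :=
  [set mu : 'cV[R]_N | (forall i, 0 <= mu i 0) /\
            (Emx - gamma *: P)^T *m mu = (1 - gamma) *: nu0].

Definition feas k (gamma : R) (nu0 : 'cV[R]_n) (Psi : 'M[R]_(N, k))
    (P : 'M[R]_(N, n)) (b : 'cV[R]_k) : set 'cV[R]_N :=
  [set mu : 'cV[R]_N | occ gamma nu0 P mu /\ (forall j, (Psi^T *m mu) j 0 <= b j 0)].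

Definition RL (f : 'cV[R]_N -> R) (F : set 'cV[R]_N) (r : 'cV[R]_N) : set 'cV[R]_N :=
  [set mu : 'cV[R]_N | F mu /\ forall nu, F nu -> dotv r nu - f nu <= dotv r mu - f mu].

Definition irl_obj (f : 'cV[R]_N -> R) (F : set 'cV[R]_N) (muh r : 'cV[R]_N) : R :=
  sup [set dotv r (mu - muh) - f mu | mu in F].

Definition IRL (f : 'cV[R]_N -> R) (Rcls F : set 'cV[R]_N) (muh : 'cV[R]_N)
  : set 'cV[R]_N :=
  [set r : 'cV[R]_N | Rcls r /\ forall r', Rcls r' -> irl_obj f F muh r <= irl_obj f F muh r'].

End MDP.

Section Convex.
Variables (R : realType) (d : nat).

Definition convex_on (C : set 'cV[R]_d) (f : 'cV[R]_d -> R) : Prop :=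
  forall x y t, C x -> C y -> 0 <= t <= 1 ->
    f (t *: x + (1 - t) *: y) <= t * f x + (1 - t) * f y.

Definition strictly_convex_on (C : set 'cV[R]_d) (f : 'cV[R]_d -> R) : Prop :=
  forall x y t, C x -> C y -> x != y -> 0 < t < 1 ->
    f (t *: x + (1 - t) *: y) < t * f x + (1 - t) * f y.

Definition aff_hull (C : set 'cV[R]_d) : set 'cV[R]_d :=
  [set y : 'cV[R]_d | exists (p : nat) (x : 'I_p -> 'cV[R]_d) (w : 'I_p -> R),
      (forall i, C (x i)) /\ \sum_i w i = 1 /\ y = \sum_i w i *: x i].

Definition relint (C : set 'cV[R]_d) : set 'cV[R]_d :=
  [set x : 'cV[R]_d | C x /\ exists e : R, 0 < e /\
      forall y, aff_hull C y -> `|y - x| < e -> C y].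

Definition grad (f : 'cV[R]_d -> R) (x : 'cV[R]_d) : 'cV[R]_d :=
  \col_i ('d f x (delta_mx i 0 : 'cV[R]_d)).

Definition essentially_smooth (X M : set 'cV[R]_d) (f : 'cV[R]_d -> R) : Prop :=
  ((forall x, (interior X) x -> differentiable f x) /\ relint M `<=` interior X)
  /\ (forall (u : nat -> 'cV[R]_d) (x : 'cV[R]_d),
        (forall k, (interior X) (u k)) -> u @ \oo --> x ->
        (M `\` relint M) x ->
        (fun k => `|grad f (u k)|) @ \oo --> +oo).

End Convex.

Definition generalizes (R : realType) (n m k : nat) (gamma : R) (nu0 : 'cV[R]_n)
    (Psi : 'M[R]_(m * n, k)) (f : 'cV[R]_(m * n) -> R) (Rcls : set 'cV[R]_(m * n))
    (muE : 'cV[R]_(m * n)) (P0 : 'M[R]_(m * n, n)) (b0 : 'cV[R]_k)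
    (Pset : set 'M[R]_(m * n, n)) (Bset : set 'cV[R]_k) : Prop :=
  forall P b r r', Pset P -> Bset b ->
    IRL f Rcls (feas gamma nu0 Psi P0 b0) muE r ->
    IRL f Rcls (feas gamma nu0 Psi P0 b0) muE r' ->
    RL f (feas gamma nu0 Psi P b) r = RL f (feas gamma nu0 Psi P b) r'.

(* Main.v *)
Require Import Defs.
From HB Require Import structures.
From mathcomp Require Import all_boot all_order all_algebra.
From mathcomp Require Import all_classical all_reals all_analysis.
From mathcomp Require Import ring lra.
Set Implicit Arguments. Unset Strict Implicit. Unset Printing Implicit Defensive.
Import Order.TTheory GRing.Theory Num.Theory.
Import numFieldNormedType.Exports.
Local Open Scope classical_set_scope.
Local Open Scope ring_scope.

(* IRL at (P0, b0) consists of the rewards in the class for which muE is       *)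
(* optimal, so it contains rE.  If r is another one and RL agrees at r and rE   *)
(* for a law P and a slack b, a common maximizer mu over the occupancy          *)
(* polytope of P is relatively interior by essential smoothness, and the first  *)
(* order conditions for both rewards put r - rE in the range of E - g P.        *)
(* Moving the single row (s0, a0) of P0 towards each vertex of the simplex      *)
(* leaves only constants in the intersection of these ranges: the other actions *)
(* (m > 1) already determine the preimage v of r - rE, and the moved row then   *)
(* forces every v j to equal the mean of v under P0.  Conversely a constant     *)
(* shift of the reward is invisible because occupancy measures have mass 1.     *)

(** Generalization forces r - rE to be constant for every IRL solution r, and [RL_IRL] makes rE
    itself a solution to compare with. For one law P the comparison is [RL_eq_range]: maximizers
    exist by compactness ([RL_exists]), a large bound b makes the linear constraints vacuous
    ([feas_unconstrained]), a maximizer cannot sit on the relative boundary, where gradients explode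
    ([maximizer_relint]), and it is therefore stationary along the kernel of (E - g P)^T for both
    rewards ([RL_diff]). Hence r - rE is orthogonal to that kernel, that is, in the range of E - g
    P.

    The relative interior argument moves towards a strictly positive occupancy measure. Hypothesis
    (i) gives one for P0, and [occ_gt0] carries it to laws dominating a positive multiple of P0,
    through positivity of the solutions of x = g x A + q. Finally [range_perturb_const] intersects
    the ranges for P0 and its one-row perturbations. *)

Section Resolvent.
Context {R : realType}.

Definition stochastic p q (A : 'M[R]_(p, q)) :=
  (forall i j, 0 <= A i j) /\ (forall i, \sum_j A i j = 1).

Lemma stochastic_sum p q (A : 'M[R]_(p, q)) (x : 'rV[R]_p) :
  stochastic A -> \sum_j (x *m A) 0 j = \sum_i x 0 i.
Proof.
move=> [_ A1]; under eq_bigr do rewrite mxE.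
by rewrite exchange_big /=; apply: eq_bigr => i _; rewrite -mulr_sumr A1 mulr1.
Qed.

Lemma stochastic_l1 p q (A : 'M[R]_(p, q)) (x : 'rV[R]_p) :
  stochastic A -> \sum_j `|(x *m A) 0 j| <= \sum_i `|x 0 i|.
Proof.
move=> [A0 A1]; pose y : 'rV[R]_p := \row_i `|x 0 i|.
have -> : \sum_i `|x 0 i| = \sum_j (y *m A) 0 j.
  by rewrite stochastic_sum //; apply: eq_bigr => i _; rewrite mxE.
apply: ler_sum => j _; rewrite !mxE; apply: le_trans (ler_norm_sum _ _ _) _.
by apply: ler_sum => i _; rewrite mxE normrM (ger0_norm (A0 _ _)).
Qed.

Lemma sum_ge0_eq0 (I : finType) (F : I -> R) :
  (forall i, 0 <= F i) -> \sum_i F i <= 0 -> forall i, F i = 0.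
Proof.
move=> F0 Fs i; apply/eqP; rewrite eq_le F0 andbT.
by apply: le_trans Fs; rewrite (bigD1 i) //= lerDl sumr_ge0.
Qed.

Variables (p : nat) (g : R) (A : 'M[R]_p).
Hypotheses (g01 : 0 < g < 1) (stA : stochastic A).

(** A left kernel vector satisfies v = g v A, and A does not increase the l1 norm, so |v|_1 <= g
    |v|_1 with g < 1. *)
Lemma unitmx_resolvent : 1%:M - g *: A \in unitmx.
Proof.
rewrite -row_free_unit; apply: inj_row_free => v /eqP.
rewrite mulmxBr mulmx1 -scalemxAr subr_eq0 => /eqP vE.
apply/rowP => i; rewrite mxE; apply/eqP; rewrite -normr_eq0; apply/eqP; move: i.
apply: sum_ge0_eq0 => [i|]; first exact: normr_ge0.
have : \sum_i `|v 0 i| = g * \sum_i `|(v *m A) 0 i|.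
  rewrite mulr_sumr; apply: eq_bigr => i _.
  by rewrite {1}vE mxE normrM gtr0_norm //; case/andP: g01.
have /andP[g0 g1] := g01.
move: (stochastic_l1 v stA); set a := \sum_i _; set b := \sum_i _.
by move=> le_ab ba; nra.
Qed.

(* Summing x = g x A + q gives (1 - g) |x|_1 <= |q|_1 = (1 - g) sum x. *)
Lemma resolvent_ge0 (x q : 'rV[R]_p) :
  x = g *: (x *m A) + q -> (forall i, 0 <= q 0 i) -> forall i, 0 <= x 0 i.
Proof.
have /andP[g0 g1] := g01.
move=> xE q0 i.
have xj j : x 0 j = g * (x *m A) 0 j + q 0 j by rewrite {1}xE !mxE.
suff /(_ i) /eqP : forall i, `|x 0 i| - x 0 i = 0.
  by rewrite subr_eq0 => /eqP <-.
apply: sum_ge0_eq0 => [j|]; first by rewrite subr_ge0 ler_norm.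
rewrite sumrB.
have : \sum_i `|x 0 i| <= g * \sum_i `|(x *m A) 0 i| + \sum_i q 0 i.
  rewrite mulr_sumr -big_split; apply: ler_sum => j _.
  rewrite xj; apply: le_trans (ler_normD _ _) _.
  by rewrite normrM gtr0_norm // (ger0_norm (q0 _)).
have : \sum_i x 0 i = g * \sum_i x 0 i + \sum_i q 0 i.
  rewrite -(stochastic_sum x stA) mulr_sumr -big_split /=.
  by rewrite (stochastic_sum x stA); apply: eq_bigr => j _; rewrite {1}xE !mxE.
move: (stochastic_l1 x stA).
by set a := \sum_i _; set b := \sum_i _; set c := \sum_i _; set d := \sum_i _; nra.
Qed.

Lemma resolvent_exists (q : 'rV[R]_p) : exists x, x = g *: (x *m A) + q.
Proof.
exists (q *m invmx (1%:M - g *: A)); set x := _ *m invmx _.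
have : x *m (1%:M - g *: A) = q by rewrite mulmxKV // unitmx_resolvent.
by rewrite mulmxBr mulmx1 -scalemxAr => <-; rewrite addrC subrK.
Qed.

Lemma resolvent_inj (v : 'cV[R]_p) : v = g *: (A *m v) -> v = 0.
Proof.
move=> vE; have : (1%:M - g *: A) *m v = 0.
  by rewrite mulmxBl mul1mx -scalemxAl -vE subrr.
move/(congr1 (mulmx (invmx (1%:M - g *: A)))).
by rewrite mulKmx ?unitmx_resolvent // mulmx0.
Qed.

(* The zero set of x is not entered by A0 from its complement, so d carries *)
(* no more than g times its own mass there.                                  *)
Lemma resolvent_gt0 (A0 : 'M[R]_p) (e : R) (d x q : 'rV[R]_p) :
  stochastic A0 -> 0 < e -> (forall i j, e * A0 i j <= A i j) ->
  (forall i, 0 <= q 0 i) -> (forall i, 0 < d 0 i) ->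
  d = g *: (d *m A0) + q -> x = g *: (x *m A) + q -> forall i, 0 < x 0 i.
Proof.
have /andP[g0 g1] := g01; have [Age0 _] := stA.
move=> [A00 A01] e0 leA q0 d0 dE xE i.
have xeq j : x 0 j = g * (x *m A) 0 j + q 0 j by rewrite {1}xE !mxE.
have x0 := resolvent_ge0 xE q0.
pose z : 'cV[R]_p := \col_i (x 0 i == 0)%:R.
(* At a zero of x every nonnegative term of g x A + q vanishes; the domination e A0 <= A passes the
   vanishing entries of A on to A0. *)
have zero j : x 0 j = 0 -> q 0 j = 0 /\ forall l, x 0 l != 0 -> A0 l j = 0.
  move=> xj; have : 0 = g * (x *m A) 0 j + q 0 j.
    by rewrite -xeq.
  have S0 : 0 <= (x *m A) 0 j by rewrite mxE sumr_ge0 // => l _; rewrite mulr_ge0.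
  have qj := q0 j => E0; have /eqP := E0.
  rewrite eq_sym paddr_eq0 ?(mulr_ge0 (ltW g0)) // => /andP[].
  rewrite mulf_eq0 (gt_eqF g0) /= => /eqP S /eqP ->; split => // l xl.
  have : x 0 l * A l j = 0.
    apply: (@sum_ge0_eq0 _ (fun l => x 0 l * A l j)).
      by move=> l'; rewrite mulr_ge0.
    by move: S; rewrite mxE => ->.
  move/eqP; rewrite mulf_eq0 (negbTE xl) /= => /eqP Al.
  by have := leA l j; have := A00 l j; rewrite Al; nra.
(* With z the indicator of the zero set, this says that A0 enters the set only from itself. It
   yields d z <= g (d z), hence d z = 0, and d > 0 empties the set. *)
have Az l : (A0 *m z) l 0 <= z l 0.
  rewrite !mxE; have [xl|xl] := eqVneq (x 0 l) 0.
    rewrite -(A01 l); apply: ler_sum => j _; rewrite mxE.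
    by case: eqP => _; rewrite ?mulr1 ?mulr0.
  rewrite big1 // => j _; rewrite mxE; case: eqP => [/zero[_ ->]//|_].
    by rewrite mul0r.
  by rewrite mulr0.
have zge l : 0 <= z l 0 by rewrite mxE ler0n.
have : (d *m z) 0 0 = g * (d *m (A0 *m z)) 0 0 + (q *m z) 0 0.
  by rewrite {1}dE mulmxDl -scalemxAl mulmxA !mxE.
have -> : (q *m z) 0 0 = 0.
  rewrite mxE big1 // => l _; rewrite mxE; case: eqP => [/zero[-> _]|_].
    by rewrite mul0r.
  by rewrite mulr0.
have : (d *m (A0 *m z)) 0 0 <= (d *m z) 0 0.
  by rewrite ![(d *m _) _ _]mxE; apply: ler_sum => l _; rewrite ler_pM2l.
rewrite addr0 => le1 dz.
have dz0 : (d *m z) 0 0 <= 0 by nra.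
have : d 0 i * z i 0 = 0.
  apply: (@sum_ge0_eq0 _ (fun i => d 0 i * z i 0)).
    by move=> l; exact: mulr_ge0 (ltW (d0 l)) (zge l).
  by rewrite mxE in dz0.
rewrite lt_def x0 andbT; move/eqP; rewrite mulf_eq0 gt_eqF //= mxE.
by case: (x 0 i == 0) => //; rewrite oner_eq0.
Qed.

End Resolvent.

(** * Occupancy measures and perturbed transition laws *)

Section Occupancy.
Context {R : realType} {n m : nat}.
Local Notation N := (m * n)%N.
Local Notation E := (@Emx R n m).

Lemma sa_inj (s s' : 'I_n) (a a' : 'I_m) :
  (sa s a == sa s' a') = (s == s') && (a == a').
Proof.
apply/eqP/andP => [|[/eqP-> /eqP->]//].
rewrite /sa => h.
(* Equal indices give equal unit vectors, which [mxvec] identifies with unit matrices whose row and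
   column can be compared. *)
have := congr1 (fun k => (delta_mx 0 (mxvec_index a s) : 'rV[R]_N) 0 k) h.
rewrite -!mxvec_delta !mxvecE !mxE !eqxx /=.
by case: eqP => [->|_]; case: eqP => [->|_] //= /eqP; rewrite oner_eq0.
Qed.

Lemma EmxE s a s' : E (sa s a) s' = (s == s')%:R.
Proof.
rewrite mxE (bigD1 a) //= (bigD1 s) //= eqxx /= big1 ?addr0 => [|s1 ne].
  rewrite big1 ?addr0 // => a1 ne; rewrite big1 // => s1 _.
  by rewrite sa_inj [a == _]eq_sym (negbTE ne) andbF.
by rewrite sa_inj [s == _]eq_sym (negbTE ne).
Qed.

(** Seen as a stochastic matrix, E sends a measure on pairs to its state marginal and preserves
    mass. *)
Lemma Emx_stochastic : stochastic E.
Proof.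
split=> i; case/mxvec_indexP: i => a s; first by move=> j; rewrite EmxE ler0n.
rewrite (bigD1 s) //= EmxE eqxx big1 ?addr0 // => s' ne.
by rewrite EmxE eq_sym (negbTE ne).
Qed.

Lemma Emx_idem i s s' : E i s * E i s' = E i s * (s == s')%:R.
Proof.
case/mxvec_indexP: i => a s0; rewrite !EmxE.
by have [->|_] := eqVneq s0 s; rewrite ?mul1r ?mul0r.
Qed.

Variables (g : R) (nu0 : 'cV[R]_n).
Hypotheses (g01 : 0 < g < 1) (hnu : simplex nu0).

(** The row-vector form turns the flow constraint into an equation of the resolvent type x = g x A +
    q. *)
Lemma occP (P : 'M[R]_(N, n)) mu : occ g nu0 P mu <->
  (forall i, 0 <= mu i 0) /\ mu^T *m E = g *: (mu^T *m P) + (1 - g) *: nu0^T.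
Proof.
split=> -[mu0 muE]; split => //.
  move/(congr1 trmx): muE; rewrite trmx_mul trmxK mulmxBr -scalemxAr.
  by rewrite [((1 - g) *: _)^T]linearZ /= => <-; rewrite addrC subrK.
apply: trmx_inj; rewrite trmx_mul trmxK mulmxBr -scalemxAr muE.
by rewrite [((1 - g) *: _)^T]linearZ /= addrC addKr.
Qed.

(** Summing the flow equation gives S = g S + (1 - g) for the total mass S. *)
Lemma occ_simplex (P : 'M[R]_(N, n)) mu :
  transition_laws P -> occ g nu0 P mu -> simplex mu.
Proof.
move=> tP /occP [mu0 muE]; split => //.
have := stochastic_sum mu^T Emx_stochastic.
rewrite muE (eq_bigr (fun j => g * (mu^T *m P) 0 j + (1 - g) * nu0^T 0 j));
  last by move=> j _; rewrite !mxE.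
rewrite big_split /= -!mulr_sumr (stochastic_sum _ tP).
have -> : \sum_i nu0^T 0 i = 1.
  by have [_ <-] := hnu; apply: eq_bigr => i _; rewrite mxE.
have -> : \sum_i mu^T 0 i = \sum_i mu i 0 by apply: eq_bigr => i _; rewrite mxE.
have /andP[g0 g1] := g01.
by set S := \sum_i _ => h; have : (1 - g) * (S - 1) = 0 by [nra|];
  move/eqP; rewrite mulf_eq0 !subr_eq0 (gt_eqF g1) /= => /eqP.
Qed.

(* The policy mub(s,a) / mub(s) is kept and the transition law changed. *)
Lemma occ_gt0 (P0 P : 'M[R]_(N, n)) e mub : (0 < m)%N ->
  transition_laws P0 -> transition_laws P ->
  0 < e -> (forall i j, e * P0 i j <= P i j) ->
  occ g nu0 P0 mub -> (forall i, 0 < mub i 0) ->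
  exists2 mu, occ g nu0 P mu & forall i, 0 < mu i 0.
Proof.
move=> m0 tP0 tP e0 leP /occP[_ mubE] mub0.
have [E0 E1] := Emx_stochastic.
pose d := mub^T *m E.
have d0 s : 0 < d 0 s.
  rewrite mxE (bigD1 (sa s (Ordinal m0))) //= EmxE eqxx mulr1 mxE.
  by rewrite ltr_pwDl // sumr_ge0 // => i _; rewrite mxE mulr_ge0 // ltW.
(* T is the policy of [mub], the conditional law of the pair given the state: d T recovers [mub], T
   E = 1, and T Q is the state chain under a law Q. *)
pose T : 'M[R]_(n, N) := \matrix_(s, i) (E i s * mub i 0 / d 0 s).
have T0 s i : 0 <= T s i by rewrite mxE !mulr_ge0 // ?invr_ge0 ltW.
have dT : d *m T = mub^T.
  apply/rowP => i; rewrite [LHS]mxE [RHS]mxE -[RHS]mul1r -(E1 i) mulr_suml.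
  by apply: eq_bigr => s _; rewrite [T _ _]mxE mulrC divfK // gt_eqF.
have TE : T *m E = 1%:M.
  apply/matrixP => s s'; rewrite [LHS]mxE mxE.
  transitivity (\sum_i mub^T 0 i * E i s * ((s == s')%:R / d 0 s)).
    apply: eq_bigr => i _; rewrite [T _ _]mxE [mub^T _ _]mxE.
    by rewrite mulrAC [_ * mub _ _ * _]mulrAC Emx_idem; ring.
  rewrite -mulr_suml.
  have -> : \sum_i mub^T 0 i * E i s = d 0 s by rewrite [RHS]mxE.
  by rewrite mulrCA divff ?mulr1 // gt_eqF.
have stT Q : transition_laws Q -> stochastic (T *m Q).
  move=> [Q0 Q1]; split=> s => [s'|].
    by rewrite mxE sumr_ge0 // => i _; rewrite mulr_ge0.
  have := stochastic_sum (row s T) (conj Q0 Q1).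
  have := stochastic_sum (row s T) Emx_stochastic.
  rewrite -!row_mul TE => <-.
  rewrite (eq_bigr (fun j => (T *m Q) s j)) => [->|j _]; last by rewrite mxE.
  rewrite (bigD1 s) //= !mxE eqxx big1 ?addr0 // => j ne.
  by rewrite !mxE eq_sym (negbTE ne).
have [nu00 _] := hnu; have /andP[_ g1] := g01.
pose q := (1 - g) *: nu0^T.
have q0 i : 0 <= q 0 i by rewrite !mxE mulr_ge0 // subr_ge0 ltW.
(* x is the state marginal of the same policy under P, compared with d, the marginal under P0. *)
have [x xE] := resolvent_exists g01 (stT _ tP) q.
have x0 : forall i, 0 < x 0 i.
  apply: (resolvent_gt0 g01 (stT _ tP) (stT _ tP0) e0 _ q0 d0 _ xE).
    move=> s s'; rewrite mxE [leRHS]mxE mulr_sumr; apply: ler_sum => i _.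
    by rewrite mulrCA ler_wpM2l.
  by rewrite mulmxA dT /d mubE.
exists (x *m T)^T; last first.
  move=> i; rewrite mxE mxE.
  case/mxvec_indexP: i => a s.
  rewrite (bigD1 s) //= ltr_pwDl //.
    rewrite mulr_gt0 // mxE -/(sa s a) EmxE eqxx mul1r divr_gt0 //.
  by rewrite sumr_ge0 // => s' _; rewrite mulr_ge0 // ltW.
apply/occP; split.
  by move=> i; rewrite mxE mxE sumr_ge0 // => s' _; rewrite mulr_ge0 // ltW.
by rewrite trmxK -!mulmxA TE mulmx1.
Qed.

Definition perturb_row (P : 'M[R]_(N, n)) (i : 'I_N) (j : 'I_n) (t : R) :
    'M[R]_(N, n) :=
  \matrix_(i', s) (P i' s + (i' == i)%:R * t * ((s == j)%:R - P i' s)).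

Lemma perturb_row_law (P : 'M[R]_(N, n)) i j t : 0 <= t <= 1 ->
  transition_laws P -> transition_laws (perturb_row P i j t).
Proof.
move=> /andP[t0 t1] [P0 P1]; split=> i' => [s|].
  rewrite mxE; have := P0 i' s; case: (i' == i); case: (s == j) => /=; nra.
under eq_bigr do rewrite mxE.
rewrite big_split /= P1 -mulr_sumr sumrB P1 (bigD1 j) //= eqxx big1.
  by rewrite addr0 subrr mulr0 addr0.
by move=> s /negbTE ->.
Qed.

(** Provides the domination that [occ_gt0] asks for, with constant 1 - t. *)
Lemma perturb_row_ge (P : 'M[R]_(N, n)) i j t : 0 <= t <= 1 -> transition_laws P ->
  forall i' s, (1 - t) * P i' s <= perturb_row P i j t i' s.
Proof.
move=> /andP[t0 t1] [P0 _] i' s.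
by rewrite mxE; have := P0 i' s; case: (i' == i); case: (s == j) => /=; nra.
Qed.

(* With a second action available, the rows other than (s0,a0) already      *)
(* determine v, so it is common to all perturbations of the row (s0,a0).     *)
Lemma range_perturb_const (P : 'M[R]_(N, n)) (s0 : 'I_n) (a0 a1 : 'I_m) t
    (w : 'cV[R]_N) : a0 != a1 -> 0 < t -> transition_laws P ->
  (exists v, w = (E - g *: P) *m v) ->
  (forall j, exists v, w = (E - g *: perturb_row P (sa s0 a0) j t) *m v) ->
  exists c, w = c *: const_mx 1.
Proof.
move=> ne t0 [P0 P1] [v vE] vjE.
have row_range Q u s a : ((E - g *: Q) *m u) (sa s a) 0 =
    u s 0 - g * (Q *m u) (sa s a) 0.
  rewrite mulmxBl -scalemxAl !mxE; congr (_ - _).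
  rewrite (bigD1 s) //= EmxE eqxx mul1r big1 ?addr0 // => s' ne'.
  by rewrite EmxE eq_sym (negbTE ne') mul0r.
pose i0 := sa s0 a0.
have pert j u i : (perturb_row P i0 j t *m u) i 0 =
    (P *m u) i 0 + (i == i0)%:R * t * (u j 0 - (P *m u) i 0).
  rewrite !mxE; under eq_bigr do rewrite mxE mulrDl -mulrA mulrBl.
  rewrite big_split /= -mulr_sumr sumrB; congr (_ + _ * (_ - _)).
  by rewrite (bigD1 j) //= eqxx mul1r big1 ?addr0 // => s /negbTE ->; rewrite mul0r.
have vj j : v j 0 = (P *m v) i0 0.
  have [u uE] := vjE j.
  have uv : u = v.
    (* A is the state chain that always plays [a1]. Its rows are unperturbed, so u - v is a fixed
       point of g A. *)
    pose A : 'M[R]_n := \matrix_(s, s') P (sa s a1) s'.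
    have stA : stochastic A.
      split=> s => [s'|]; first by rewrite mxE.
      by under eq_bigr do rewrite mxE.
    apply/eqP; rewrite -subr_eq0; apply/eqP; apply: (resolvent_inj g01 stA).
    apply/colP => s; rewrite mxE [RHS]mxE.
    have := congr1 (fun x : 'cV[R]_N => x (sa s a1) 0) uE.
    rewrite {1}vE !row_range pert sa_inj [a1 == _]eq_sym (negbTE ne) andbF.
    have -> : (A *m (u - v)) s 0 = (P *m u) (sa s a1) 0 - (P *m v) (sa s a1) 0.
      rewrite !mxE -sumrB; apply: eq_bigr => s' _; rewrite !mxE; ring.
    by rewrite [(- v : 'cV_n) _ _]mxE !mul0r addr0 => h; move: h; lra.
  (* Now that u = v, the two expressions at the perturbed row differ only by g t (v j - (P v)
     i0). *)
  have := congr1 (fun x : 'cV[R]_N => x i0 0) uE.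
  rewrite uv {1}vE /i0 !row_range -/i0 pert eqxx mul1r.
  have /andP[g0 _] := g01.
  move=> h; have : (g * t) * (v j 0 - (P *m v) i0 0) = 0 by lra.
  by move/eqP; rewrite mulf_eq0 gt_eqF ?mulr_gt0 //= subr_eq0 => /eqP.
exists ((1 - g) * (P *m v) i0 0); rewrite vE.
apply/colP => i; case/mxvec_indexP: i => a s; rewrite -/(sa s a) row_range.
have -> : (P *m v) (sa s a) 0 = (P *m v) i0 0.
  rewrite mxE; under eq_bigr do rewrite vj.
  by rewrite -mulr_suml P1 mul1r.
by rewrite vj [RHS]mxE [const_mx _ _ _]mxE; ring.
Qed.

End Occupancy.

(** * Norm, closedness and compactness for column vectors *)

Section MatrixTopology.
Context {R : realType}.

Lemma mx_norm_coord p q (x : 'M[R]_(p, q)) i j : `|x i j| <= `|x|.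
Proof.
rewrite [leRHS]/Num.Def.normr /= mx_normrE.
by apply/bigmax_geP; right; exists (i, j).
Qed.

Lemma mx_norm_le p q (x : 'M[R]_(p, q)) e :
  0 <= e -> (forall i j, `|x i j| <= e) -> `|x| <= e.
Proof.
move=> e0 xe; rewrite [leLHS]/Num.Def.normr /= mx_normrE.
by apply/bigmax_leP; split => // -[i j] _; exact: xe.
Qed.

Lemma trmx_continuous p q : continuous (@trmx R p q).
Proof.
move=> x s /= /(nbhs_ballP x^T) [e e0 es]; apply/nbhs_ballP; exists e => //= y [_ xy].
by apply: es; split => // i j; rewrite !mxE; exact: xy.
Qed.

Lemma closed_forall (T : topologicalType) I (F : I -> set T) :
  (forall i, closed (F i)) -> closed [set x | forall i, F i x].
Proof.
move=> cF; rewrite (_ : [set x | _] = \bigcap_(i in [set: I]) F i).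
  exact: closed_bigI.
by apply/seteqP; split=> x /= Fx i => [_|]; exact: Fx.
Qed.

Lemma dotv_continuous d (r : 'cV[R]_d) : continuous (dotv r).
Proof.
move=> x; apply: (cvg_big (F := nbhs x) add_continuous) => // i _.
by apply: cvgM; [exact: cvg_cst|exact: coord_continuous].
Qed.

Lemma mulmx_dotv p q (A : 'M[R]_(p, q)) x j :
  (A *m x) j 0 = dotv (\col_i A j i) x.
Proof. by rewrite mxE; apply: eq_bigr => i _; rewrite mxE. Qed.

Lemma closed_dotv_le d (r : 'cV[R]_d) c : closed [set x | dotv r x <= c].
Proof.
by apply: (preimage_closed _ (@closed_le R c)) => x _; exact: dotv_continuous.
Qed.

(** Compactness of products is available for row vectors and is transported by transposition. *)
Lemma unit_cube_compact d :
  compact [set x : 'cV[R]_d | forall i, 0 <= x i 0 <= 1].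
Proof.
rewrite (_ : [set x | _] =
  trmx @` [set v : 'rV[R]_d | forall i, [set` `[0 : R, 1]] (v ord0 i)]); last first.
  apply/seteqP; split=> [x /= x01|_ [v /= v01] <- i].
    by exists x^T; rewrite ?trmxK // => i; rewrite mxE /= in_itv /= x01.
  by rewrite mxE; have := v01 i; rewrite /= in_itv.
apply: continuous_compact.
  by apply: continuous_subspaceT; exact: trmx_continuous.
by apply: (@rV_compact _ _ (fun=> [set` `[0 : R, 1]])) => i; exact: segment_compact.
Qed.

End MatrixTopology.

(** * Bilinearity of the inner product *)

Section Dotv.
Context {R : realType} {d : nat}.
Implicit Types r x y : 'cV[R]_d.

Lemma dotvDr r x y : dotv r (x + y) = dotv r x + dotv r y.
Proof. by rewrite -big_split; apply: eq_bigr => i _; rewrite mxE mulrDr. Qed.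

Lemma dotvZr r c x : dotv r (c *: x) = c * dotv r x.
Proof. by rewrite mulr_sumr; apply: eq_bigr => i _; rewrite mxE mulrCA. Qed.

Lemma dotvC x y : dotv x y = dotv y x.
Proof. by apply: eq_bigr => i _; rewrite mulrC. Qed.

Lemma dotvBr r x y : dotv r (x - y) = dotv r x - dotv r y.
Proof. by rewrite -scaleN1r dotvDr dotvZr mulN1r. Qed.

Lemma dotvE r x : dotv r x = (r^T *m x) 0 0.
Proof. by rewrite mxE; apply: eq_bigr => i _; rewrite mxE. Qed.

Lemma dotv_const c x : dotv (c *: const_mx 1) x = c * \sum_i x i 0.
Proof.
by rewrite dotvC dotvZr; congr (_ * _); apply: eq_bigr => i _; rewrite mxE mulr1.
Qed.

Lemma dotvDl r r' x : dotv (r + r') x = dotv r x + dotv r' x.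
Proof. by rewrite dotvC dotvDr !(dotvC x). Qed.

End Dotv.

(** * First order conditions and essential smoothness *)

Section FirstOrder.
Context {R : realType} {d : nat}.
Implicit Types (f : 'cV[R]_d -> R) (X M : set 'cV[R]_d).

(** The directional derivative is also the limit from the right, so positive steps suffice. *)
Lemma diff_le f (u v : 'cV[R]_d) (c e : R) : differentiable f u -> 0 < e ->
  (forall h, 0 < h < e -> f (h *: v + u) - f u <= h * c) -> 'd f u v <= c.
Proof.
move=> df e0 fle; rewrite -deriveE //.
have cv0 : derivable f u v by exact: diff_derivable.
have /cvg_dnbhs_at_right cv := cv0.
have -> : 'D_v f u =
    lim (h^-1 *: ((f \o shift u) (h *: v) - f u) @[h --> (0:R)^'+]).
  apply/esym/cvg_lim => //; exact: cv.
apply: limr_le; first by apply/cvg_ex; eexists; exact: cv.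
near=> h; rewrite /= ler_pdivrMl; last by near: h; exact: nbhs_right_gt.
apply: fle; apply/andP; split; near: h; first exact: nbhs_right_gt.
exact: nbhs_right_lt.
Unshelve. all: by end_near.
Qed.

Lemma diff_ge f (u v : 'cV[R]_d) (c e : R) : differentiable f u -> 0 < e ->
  (forall h, 0 < h < e -> h * c <= f (h *: v + u) - f u) -> c <= 'd f u v.
Proof.
move=> df e0 fge; rewrite -lerN2.
have := @diff_le (- f) u v (- c) e (differentiableN df) e0.
rewrite diffN //; apply => h /fge fh.
by rewrite -[leLHS]/(- f (h *: v + u) - - f u); lra.
Qed.

Lemma convex_diff_le X f (u y : 'cV[R]_d) : convex_on X f -> X u -> X y ->
  differentiable f u -> 'd f u (y - u) <= f y - f u.
Proof.
move=> cf Xu Xy df; apply: (@diff_le _ _ _ _ 1) => // h /andP[h0 h1].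
have -> : h *: (y - u) + u = h *: y + (1 - h) *: u.
  by rewrite scalerBr scalerBl scale1r -addrA [- _ + u]addrC.
have := @cf y u h Xy Xu; rewrite (ltW h0) (ltW h1) => /(_ isT); lra.
Qed.

(** Both v and -v are feasible directions, so the one-sided optimality inequality holds for each. *)
Lemma maximizer_diff M f (r x v : 'cV[R]_d) (e : R) :
  differentiable f x -> 0 < e ->
  (forall h, `|h| < e -> M (h *: v + x)) ->
  (forall y, M y -> dotv r y - f y <= dotv r x - f x) ->
  'd f x v = dotv r v.
Proof.
move=> df e0 Mv xmax.
have key w : (forall h, `|h| < e -> M (h *: w + x)) -> dotv r w <= 'd f x w.
  move=> Mw; apply: (diff_ge df e0) => h /andP[h0 he].
  have /xmax : M (h *: w + x) by apply: Mw; rewrite gtr0_norm.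
  by rewrite dotvDr dotvZr; lra.
apply/eqP; rewrite eq_le key // andbT.
have : dotv r (- v) <= 'd f x (- v).
  by apply: key => h he; rewrite scalerN -scaleNr; apply: Mv; rewrite normrN.
by rewrite linearN -scaleN1r dotvZr mulN1r lerN2.
Qed.

(* If x were not relatively interior, then along the segment towards z the   *)
(* gradient inequality at u in the directions x and z + h would bound        *)
(* grad f u . h by f (z + h) - f x - r . (z - x), whereas it must blow up.   *)
Lemma maximizer_relint X M f (r x z : 'cV[R]_d) : convex_on X f -> M `<=` X ->
  essentially_smooth X M f -> M x ->
  (forall t, 0 < t <= 1 -> relint M (t *: (z - x) + x)) ->
  (forall y, M y -> dotv r y - f y <= dotv r x - f x) -> relint M x.
Proof.
move=> cf MX [[fd rX] blow] Mx seg xmax; apply: contrapT => nrel.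
pose t k : R := k.+1%:R^-1.
pose u k := t k *: (z - x) + x.
have t01 k : 0 < t k <= 1 by rewrite invr_gt0 ltr0n invf_le1 ?ltr0n // ler1n.
have urel k : relint M (u k) by exact: seg.
have uint k : interior X (u k) by exact/rX/urel.
have ucvg : u @ \oo --> x.
  suff : u @ \oo --> 0 *: (z - x) + x by rewrite scale0r add0r.
  by apply: cvgD; [apply: cvgZ; [exact: cvg_harmonic|exact: cvg_cst]|exact: cvg_cst].
have zint : interior X z.
  by have := seg 1; rewrite ltr01 lexx scale1r subrK => /(_ isT) /rX.
have [e /= e0 eX] : exists2 e : R, 0 < e & forall y, `|y - z| <= e -> X y.
  have /nbhs_ballP[e /= e0 eX] : nbhs z X by [].
  exists (e / 2); first by rewrite divr_gt0.
  move=> y yz; apply: eX; rewrite -ball_normE /= distrC.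
  by apply: le_lt_trans yz _; rewrite ltr_pdivrMr // mulr_natr mulr2n ltrDl.
(* The point of this bound is that it does not depend on k. *)
pose K h := f (z + h) - f x - dotv r (z - x).
have bound k h : `|h| <= e -> 'd f (u k) h <= K h.
  move=> he; have Xu := interior_subset (uint k); have du := fd _ (uint k).
  have Xzh : X (z + h) by apply: eX; rewrite addrC addKr.
  have := convex_diff_le cf Xu (MX _ Mx) du.
  have -> : x - u k = - t k *: (z - x) by rewrite /u opprD addrCA subrr addr0 scaleNr.
  rewrite linearZ /=; set D := 'd f (u k) (z - x) => lex.
  have := convex_diff_le cf Xu Xzh du.
  have -> : z + h - u k = h + (1 - t k) *: (z - x).
    by apply/colP => l; rewrite !mxE; ring.
  rewrite linearD linearZ /= -/D => lez.
  have [Mu _] := urel k; have := xmax _ Mu; rewrite {1}/u dotvDr dotvZr => lem.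
  have /andP[tk0 tk1] := t01 k; rewrite /K.
  move: lex lez lem; rewrite -!/(u k) -![_ *: D]/(_ * D).
  set rD := dotv r (z - x); set fu := f (u k); move=> lex lez lem.
  (* The gradient inequality towards x and the optimality of x give t rD <= f u - f x <= t D;
     substituting into the inequality towards z + h replaces both f u and D. *)
  have : rD <= D by rewrite -(ler_pM2l tk0); lra.
  by nra.
pose del (i : 'I_d) : 'cV[R]_d := delta_mx i 0.
(* Steps of length e in both directions of each axis bound each partial derivative in absolute
   value. *)
pose B := \sum_i (`|K (e *: del i)| + `|K (- e *: del i)|) / e.
have gradB k : `|grad f (u k)| <= B.
  apply: mx_norm_le => [|i j].
    by rewrite sumr_ge0 // => i _; rewrite divr_ge0 ?addr_ge0 // ltW.
  rewrite ord1 mxE /B (bigD1 i) //= -[leLHS]addr0 lerD //; last first.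
    by rewrite sumr_ge0 // => l _; rewrite divr_ge0 ?addr_ge0 // ltW.
  rewrite ler_pdivlMr // -/(del i).
  have nd c : `|c| = e -> `|c *: del i| <= e.
    move=> ce; apply: mx_norm_le => [|l l']; first exact: ltW.
    rewrite mxE mxE; case: andP => _; rewrite ?mulr1 ?mulr0 ?normr0 ?ce //.
    exact: ltW.
  have ee : `|e| = e := gtr0_norm e0.
  have := bound k _ (nd e ee); have := bound k _ (nd (- e) (etrans (normrN e) ee)).
  rewrite !linearZ /= -![_ *: 'd f _ _]/(_ * _).
  set D := 'd f (u k) (del i) => K2 K1.
  have := ler_norm (K (e *: del i)); have := ler_norm (K (- e *: del i)).
  have := normr_ge0 (K (e *: del i)); have := normr_ge0 (K (- e *: del i)).
  move=> k1 k2 k3 k4; rewrite -[e in leLHS]ee -normrM ler_norml.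
  by apply/andP; split; lra.
have := blow u x uint ucvg (conj Mx nrel).
move/cvgryPgt => /(_ B)[k0 _ /(_ k0 (leqnn _))] /=.
by rewrite ltNge gradB.
Qed.

End FirstOrder.

(** * Relative interior of the occupancy polytope: its strictly positive points *)

Section OccupancyRelint.
Context {R : realType} {n m : nat}.
Local Notation N := (m * n)%N.
Local Notation E := (@Emx R n m).
Variables (g : R) (nu0 : 'cV[R]_n) (P : 'M[R]_(N, n)).
Implicit Types mu x y : 'cV[R]_N.

Lemma gt0_lower_bound mu : (forall i, 0 < mu i 0) ->
  exists2 e : R, 0 < e & forall i, e <= mu i 0.
Proof.
(* The default 1 keeps the minimum positive when there are no coordinates. *)
move=> mu0; exists (\big[Num.min/1]_i mu i 0); first exact: lt_bigmin.
by move=> i; apply: bigmin_le_cond.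
Qed.

Lemma aff_hull_occ y : aff_hull (occ g nu0 P) y ->
  (E - g *: P)^T *m y = (1 - g) *: nu0.
Proof.
move=> [p [x [w [xM [w1 ->]]]]]; rewrite mulmx_sumr.
under eq_bigr => i _ do rewrite -scalemxAr (xM i).2.
by rewrite -scaler_suml w1 scale1r.
Qed.

(** The affine hull already satisfies the flow equation, so only nonnegativity is at stake, and it
    survives small moves. *)
Lemma occ_relint x : occ g nu0 P x -> (forall i, 0 < x i 0) ->
  relint (occ g nu0 P) x.
Proof.
move=> Mx x0; split => //; have [e e0 ex] := gt0_lower_bound x0.
exists e; split => // y /aff_hull_occ yE yx; split => // i.
have := mx_norm_coord (y - x) i 0; rewrite !mxE => h.
have := ex i; have := le_lt_trans h yx; rewrite ltr_norml => /andP[? _]; lra.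
Qed.

(** The segment from z to x can be prolonged slightly beyond x; a zero coordinate of x would become
    negative there. *)
Lemma relint_occ_gt0 x z : occ g nu0 P z -> (forall i, 0 < z i 0) ->
  relint (occ g nu0 P) x -> forall i, 0 < x i 0.
Proof.
move=> Mz z0 [Mx [e [e0 xe]]] i.
pose t := e / 2 / (1 + `|x - z|).
have n0 : 0 < 1 + `|x - z| by rewrite ltr_pwDl.
have t0 : 0 < t by rewrite !divr_gt0.
have /xe yM : aff_hull (occ g nu0 P) (x + t *: (x - z)).
  exists 2, (fun i : 'I_2 => if i == ord0 then x else z),
    (fun i : 'I_2 => if i == ord0 then 1 + t else - t).
  split; first by move=> j; case: ifP.
  rewrite !big_ord_recl !big_ord0 /=; split; first by rewrite addr0 addrK.
  by rewrite addr0 scalerDl scale1r scalerBr scaleNr addrA.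
have [|yM0 _] := yM.
  rewrite addrC addKr normrZ gtr0_norm // -mulrA.
  have : (1 + `|x - z|)^-1 * `|x - z| <= 1 by rewrite ler_pdivrMl // mulr1 lerDr.
  by move=> h; nra.
have := yM0 i; rewrite !mxE; have := z0 i; have := Mx.1 i.
set a := x i 0; set b := z i 0 => a0 b0 h.
by rewrite lt_def a0 andbT; apply/eqP => a00; nra.
Qed.

Lemma occ_segment x z t : occ g nu0 P x -> occ g nu0 P z ->
  (forall i, 0 < z i 0) -> 0 < t <= 1 -> relint (occ g nu0 P) (t *: (z - x) + x).
Proof.
move=> [x0 xE] [z0' zE] z0 /andP[t0 t1].
have pos i : 0 < (t *: (z - x) + x) i 0.
  by rewrite !mxE; have := x0 i; have := z0 i; nra.
apply: occ_relint => //; split; first by move=> i; exact: ltW.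
by rewrite mulmxDr -scalemxAr mulmxBr xE zE subrr scaler0 add0r.
Qed.

End OccupancyRelint.

(** * Optimal occupancy measures and the rewards they determine *)

Section Maximizers.
Context {R : realType} {n m k : nat}.
Local Notation N := (m * n)%N.
Local Notation E := (@Emx R n m).
Variables (g : R) (nu0 : 'cV[R]_n) (Psi : 'M[R]_(N, k)).
Variables (X : set 'cV[R]_N) (f : 'cV[R]_N -> R).
Hypotheses (g01 : 0 < g < 1) (hnu : simplex nu0).
Hypotheses (sX : @simplex R N `<=` X) (fcont : {within X, continuous f}).
Hypothesis (fconv : convex_on X f).

Lemma feas_compact P b : transition_laws P -> compact (feas g nu0 Psi P b).
Proof.
move=> tP; apply: subclosed_compact (@unit_cube_compact R N) _; last first.
  move=> x [Mx _] i; have [x0 x1] := occ_simplex g01 hnu tP Mx.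
  by rewrite x0 -x1 (bigD1 i) //= lerDl sumr_ge0.
have -> : feas g nu0 Psi P b =
    [set x : 'cV[R]_N | forall i, 0 <= x i 0] `&`
    [set x | forall i, dotv (\col_l (E - g *: P)^T i l) x = ((1 - g) *: nu0) i 0] `&`
    [set x | forall j, dotv (\col_l Psi^T j l) x <= b j 0].
  apply/seteqP; split=> [x [[x0 xE] xb]|x [[x0 xE] xb]].
    by split=> [|j]; [split=> // i|]; rewrite /= -mulmx_dotv ?xE.
  split=> [|j]; last by rewrite mulmx_dotv.
  by split=> //; apply/colP => i; rewrite mulmx_dotv xE.
apply: closedI; [apply: closedI|]; apply: closed_forall => i.
- by apply: (preimage_closed _ (@closed_ge R 0)) => x _; exact: coord_continuous.
- by apply: (preimage_closed _ (@closed_eq R _)) => x _; exact: dotv_continuous.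
- exact: closed_dotv_le.
Qed.

Lemma RL_exists P b r : transition_laws P -> feas g nu0 Psi P b !=set0 ->
  RL f (feas g nu0 Psi P b) r !=set0.
Proof.
move=> tP F0.
have [||x /set_mem Fx xmax] := @compact_EVT_max _ R (dotv r - f) _ F0.
- exact: feas_compact.
- apply: within_continuousB.
    by apply: continuous_subspaceT; exact: dotv_continuous.
  apply: (continuous_subspaceW _ fcont) => x [Mx _].
  exact/sX/(occ_simplex g01 hnu tP Mx).
by exists x; split => // y Fy; apply: xmax; exact: mem_set.
Qed.

(** Testing with [muE] shows that every reward has objective at least - f muE, and a reward for
    which [muE] is optimal attains this value. *)
Lemma RL_IRL Rcls P b r muE : transition_laws P ->
  Rcls r -> RL f (feas g nu0 Psi P b) r muE ->
  IRL f Rcls (feas g nu0 Psi P b) muE r.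
Proof.
move=> tP Rr [FmuE muEmax]; split => // r' _; apply: (@le_trans _ _ (- f muE)).
  apply: ge_sup; first by eexists; exists muE.
  by move=> _ [mu Fmu <-]; have := muEmax _ Fmu; rewrite dotvBr; lra.
apply: ub_le_sup; last by exists muE => //; rewrite dotvBr subrr sub0r.
(* A maximizer for r' supplies the upper bound without which [sup] carries no information. *)
have [mu [_ mumax]] := RL_exists r' tP (ex_intro _ _ FmuE).
exists (dotv r' (mu - muE) - f mu) => _ [nu Fnu <-].
by have := mumax _ Fnu; rewrite !dotvBr; lra.
Qed.

(** The maximizer is relatively interior, hence strictly positive, so small moves along a kernel
    direction stay feasible with either sign. *)
Lemma RL_diff P b r mu z : transition_laws P ->
  essentially_smooth X (occ g nu0 P) f ->
  feas g nu0 Psi P b = occ g nu0 P -> occ g nu0 P z -> (forall i, 0 < z i 0) ->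
  RL f (feas g nu0 Psi P b) r mu ->
  forall h, (E - g *: P)^T *m h = 0 -> 'd f mu h = dotv r h.
Proof.
move=> tP smooth -> Mz z0 [Mmu mumax] h hE.
have rel : relint (occ g nu0 P) mu.
  apply: (maximizer_relint fconv _ smooth Mmu _ mumax (z := z)).
    by move=> x /(occ_simplex g01 hnu tP) /sX.
  by move=> t t01; exact: occ_segment.
have [[fd rX] _] := smooth.
have mu0 := relint_occ_gt0 Mz z0 rel.
have [e e0 emu] := gt0_lower_bound mu0.
have n0 : 0 < 1 + `|h| by rewrite ltr_pwDl.
apply: (@maximizer_diff _ _ (occ g nu0 P) _ _ _ _ (e / (1 + `|h|))) => //.
- exact/fd/rX.
- exact: divr_gt0.
move=> c ce; split; last by rewrite mulmxDr -scalemxAr hE scaler0 add0r Mmu.2.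
move=> i; rewrite !mxE; have := emu i.
have : `|c * h i 0| <= e.
  rewrite normrM; have := mx_norm_coord h i 0; have := normr_ge0 c.
  by move: ce; rewrite ltr_pdivlMr // => ce c0 hi; have := normr_ge0 (h i 0); nra.
by rewrite ler_norml => /andP[+ _]; lra.
Qed.

(** Occupancy measures have entries in [0, 1], so this b dominates Psi^T mu. *)
Lemma feas_unconstrained P : transition_laws P ->
  feas g nu0 Psi P (\col_j \sum_i `|Psi i j|) = occ g nu0 P.
Proof.
move=> tP; apply/seteqP; split=> [x []//|x Mx]; split => // j.
have [x0 x1] := occ_simplex g01 hnu tP Mx.
rewrite !mxE; apply: ler_sum => i _; rewrite mxE.
apply: le_trans (ler_norm _) _; rewrite normrM (ger0_norm (x0 i)).
rewrite -[leRHS]mulr1 ler_wpM2l // -x1 (bigD1 i) //= lerDl.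
by rewrite sumr_ge0.
Qed.

Lemma RL_eq_range P r r' z : transition_laws P ->
  essentially_smooth X (occ g nu0 P) f -> occ g nu0 P z ->
  (forall i, 0 < z i 0) ->
  (forall b, RL f (feas g nu0 Psi P b) r = RL f (feas g nu0 Psi P b) r') ->
  exists v, r - r' = (E - g *: P) *m v.
Proof.
move=> tP smooth Mz z0 eqRL; have FM := feas_unconstrained tP.
have [|mu mur] := RL_exists r tP (b := \col_j \sum_i `|Psi i j|).
  by exists z; rewrite FM.
have mur' := mur; rewrite eqRL in mur'.
pose A := (E - g *: P)^T.
(* Row space membership is tested on the columns of [cokermx A], which are kernel vectors of A;
   there both rewards equal the derivative of f at the common maximizer. *)
have /submxP[D rD] : ((r - r')^T <= A)%MS.
  rewrite submxE; apply/eqP/rowP => i; rewrite [RHS]mxE.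
  have hE : A *m col i (cokermx A) = 0 
    by rewrite colE mulmxA mulmx_coker mul0mx.
  have := RL_diff tP smooth FM Mz z0 mur hE.
  rewrite (RL_diff tP smooth FM Mz z0 mur' hE) => eq.
  have := dotvE (r - r') (col i (cokermx A)).
  rewrite dotvC dotvBr !(dotvC (col _ _)) eq subrr colE mulmxA -colE.
  by rewrite [RHS]mxE.
by exists D^T; rewrite -[LHS]trmxK rD trmx_mul trmxK.
Qed.

End Maximizers.

Unset Implicit Arguments.

Theorem theorem4p10 (R : realType) (n m k : nat) (hm : (1 < m)%N)
  (nu0 : 'cV[R]_n) (gamma : R) (Psi : 'M[R]_(m * n, k))
  (X : set 'cV[R]_(m * n)) (f : 'cV[R]_(m * n) -> R)
  (Rcls : set 'cV[R]_(m * n)) (muE rE : 'cV[R]_(m * n))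
  (P0 : 'M[R]_(m * n, n)) (b0 : 'cV[R]_k) (O : set 'M[R]_(m * n, n)) :
  simplex nu0 -> 0 < gamma < 1 ->
  closed X -> convex_set X -> @simplex R (m * n) `<=` X ->
  {within X, continuous f} -> convex_on X f ->
  transition_laws P0 ->
  (* (i) Slater-type point *)
  (exists mub, occ gamma nu0 P0 mub /\ (forall i, 0 < mub i 0) /\
               (forall j, (Psi^T *m mub) j 0 < b0 j 0)) ->
  (* (ii) *)
  strictly_convex_on X f ->
  (* (iii) *)
  (forall P, transition_laws P -> essentially_smooth X (occ gamma nu0 P) f) ->
  (* (iv) *)
  convex_set Rcls -> Rcls rE -> RL f (feas gamma nu0 Psi P0 b0) rE muE ->
  nbhs P0 O ->
  (generalizes gamma nu0 Psi f Rcls muE P0 b0 (O `&` @transition_laws R n m) setT <->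
   IRL f Rcls (feas gamma nu0 Psi P0 b0) muE `<=`
     [set rE + c *: const_mx 1 | c in [set: R]]).
Proof.
move=> hnu g01 _ _ sX fcont fconv tP0 [mub [Mmub [mub0 _]]] _ smooth _ RrE.
move=> muErE /nbhs_ballP[e /= e0 eO].
have rEIRL := RL_IRL g01 hnu sX fcont tP0 RrE muErE.
split=> [gen r rIRL|sub P b r r' [_ tP] _ /sub[c _ <-] /sub[c' _ <-]]; last first.
  (* Feasible measures have mass 1, so a constant added to the reward shifts all values equally and
     keeps the maximizers. *)
  have shift c1 mu : feas gamma nu0 Psi P b mu ->
      dotv (rE + c1 *: const_mx 1) mu = dotv rE mu + c1.
    move=> [Mmu _]; have [_ mu1] := occ_simplex g01 hnu tP Mmu.
    by rewrite dotvDl dotv_const mu1 mulr1.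
  by apply/seteqP; split=> mu [Fmu mumax]; split => // nu Fnu;
    have := mumax _ Fnu; rewrite !shift //; lra.
have range P : O P -> transition_laws P ->
    (exists2 z, occ gamma nu0 P z & forall i, 0 < z i 0) ->
    exists v, r - rE = (Emx R n m - gamma *: P) *m v.
  move=> OP tP [z Mz z0].
  apply: (RL_eq_range (Psi := Psi) g01 hnu sX fcont fconv tP (smooth P tP) Mz z0).
  by move=> b; exact: gen.
(* A state exists because [nu0] has mass 1. *)
have n0 : (0 < n)%N.
  rewrite lt0n; apply/eqP => n00; have [_ /eqP] := hnu.
  rewrite big1 ?[0 == 1]eq_sym ?oner_eq0 // => i.
  by have := leq_trans (ltn_ord i) (eq_leq n00).
pose s0 := Ordinal n0; pose a0 := Ordinal (ltnW hm); pose a1 := Ordinal hm.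
(* Entries move by at most t, so t < e keeps the perturbed law in O, while t <= 1/2 keeps the
   domination constant 1 - t positive. *)
pose t := Num.min (e / 2) (1 / 2).
have te : t < e by rewrite gt_min; apply/orP; left; lra.
have t0 : 0 < t by rewrite lt_min; apply/andP; split; lra.
have t1 : t <= 1 / 2 by rewrite ge_min lexx orbT.
have t01 : 0 <= t <= 1 by apply/andP; split; lra.
have [//||j|c cE] := @range_perturb_const R n m gamma g01 P0 s0 a0 a1 t (r - rE) _ t0 tP0.
- by apply: range => //; [apply: eO; exact: ballxx|exists mub].
- have tP := perturb_row_law (sa s0 a0) j t01 tP0.
  apply: range => //.
    apply: eO; split=> // i s; rewrite /ball /= mxE.
    have [P00 P01] := tP0.
    have Pis : P0 i s <= 1 by rewrite -(P01 i) (bigD1 s) //= lerDl sumr_ge0.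
    have := P00 i s; rewrite opprD addrA subrr sub0r normrN ltr_norml.
    by case: (i == _); case: (s == j) => /= ?; apply/andP; split; nra.
  apply: (occ_gt0 g01 hnu (ltnW hm) tP0 tP (e := 1 - t) _ _ Mmub mub0); first lra.
  exact: perturb_row_ge.
by exists c => //; rewrite -cE addrC subrK.
Qed.
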